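(* Let $N\ge 1$ be an integer and let $|\varphi\rangle^{A'B'}$ be a pure bipartite state on finite-dimensional systems $A'$ (held by Alice) and $B'$ (held by Bob), with $\varphi^{A'B'}=|\varphi\rangle\langle\varphi|$. Suppose there is a LOSE instrument $\{\mathcal{L}_{x,y}\}_{x,y=0}^{N}$ with shared resource state $\varphi^{A'B'}$ that implements the transformation $$\Psi_{\phi,n}^{AB}\otimes\varphi^{A'B'}\;\longmapsto\;\Psi_{\phi,n}^{AB}\otimes\sum_{\substack{x,y\in\{0,\dots,N\}\\ x+y\equiv n \ (\mathrm{mod}\ N+1)}}p(x,y)\,|x,y\rangle\langle x,y|^{\mathsf{X}\mathsf{Y}}$$ for all $n\in\{0,1,\dots,N\}$ and all $\phi\in[0,2\pi)$, where $p(x,y)$ is an arbitrary probability distribution (allowed to depend on $n$ and $\phi$) supported on pairs with $x+y\equiv n \pmod{N+1}$. Equivalently, for all $n$, $\phi$, $x$, $y$ one has $\mathcal{L}_{x,y}(\Psi_{\phi,n})=p(x,y)\,\Psi_{\phi,n}$, with $p(x,y)=0$ whenever $x+y\not\equiv n\pmod{N+1}$. Then the entanglement entropy of the resource state satisfies $$\mathsf{E}(\varphi^{A'B'}):=S(\varphi^{A'})\ \ge\ \log(N+1),$$ where $\varphi^{A'}=\mathrm{Tr}_{B'}\,\varphi^{A'B'}$ and $S(\rho)=-\mathrm{Tr}[\rho\log\rho]$ is the von Neumann entropy.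
   Context: Time-bin states. Systems $A$ (Alice) and $B$ (Bob) each have a Hilbert space with orthonormal basis $|0\rangle,|1\rangle,\dots,|N\rangle$, where $|0\rangle$ is the vacuum (no excitation in any time-bin) and $|n\rangle$, for $1\le n\le N$, is the state with one excitation in time-bin $n$ and no excitation in the other time-bins. For $n\in\{1,\dots,N\}$ and $\phi\in[0,2\pi)$, $$|\Psi_{\phi,n}\rangle^{AB}=\tfrac{1}{\sqrt2}\left(|n\rangle^A|0\rangle^B+e^{i\phi}|0\rangle^A|n\rangle^B\right),$$ and for $n=0$, $|\Psi_{\phi,0}\rangle^{AB}=|0\rangle^A|0\rangle^B$. We write $\Psi_{\phi,n}=|\Psi_{\phi,n}\rangle\langle\Psi_{\phi,n}|$. LOSE instrument (local operations and shared entanglement). A LOSE instrument with shared resource state $\varphi^{A'B'}$ is a collection of completely positive maps $\{\mathcal{L}_{x,y}\}_{x,y=0}^N$ on system $AB$ of the form $$\mathcal{L}_{x,y}(\Psi^{AB})=\sum_\lambda p(\lambda)\,\bigl(\mathcal{A}^{AA'\to A}_{x|\lambda}\otimes\mathcal{B}^{BB'\to B}_{y|\lambda}\bigr)\bigl(\Psi^{AB}\otimes\varphi^{A'B'}\bigr),$$ where $\{p(\lambda)\}$ is a probability distribution (shared randomness), each $\mathcal{A}_{x|\lambda}$ is a completely positive map from operators on $AA'$ to operators on $A$, each $\mathcal{B}_{y|\lambda}$ is a completely positive map from operators on $BB'$ to operators on $B$, and $\sum_{x=0}^N\mathcal{A}_{x|\lambda}$ and $\sum_{y=0}^N\mathcal{B}_{y|\lambda}$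 are trace-preserving for every $\lambda$. The classical registers $\mathsf{X}$ and $\mathsf{Y}$ store the outcomes $x$ and $y$ of Alice and Bob: on input $\Psi^{AB}$ the overall output is $\sum_{x,y}\mathcal{L}_{x,y}(\Psi^{AB})\otimes|x,y\rangle\langle x,y|^{\mathsf{X}\mathsf{Y}}$. *)

(* Defs.v *)
From HB Require Import structures.
From mathcomp Require Import all_boot all_order all_algebra.
From mathcomp Require Import complex.
From mathcomp Require mxtens.
From mathcomp Require Import all_classical all_reals all_analysis.
Set Implicit Arguments.
Unset Strict Implicit.
Unset Printing Implicit Defensive.
Import Order.TTheory GRing.Theory Num.Theory.
Import numFieldNormedType.Exports.
Local Open Scope classical_set_scope.
Local Open Scope complex_scope.
Local Open Scope sesquilinear_scope.
Local Open Scope ring_scope.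

(* Not [Import]ed because its notation "A ^t k" clashes with the one of
   sesquilinear.v. *)
Notation "A *t B" := (mxtens.tensmx A B)
  (at level 40, left associativity, format "A  *t  B") : ring_scope.
Notation mxpair i j := (mxtens.mxtens_index (i, j)).
Notation mxunpair k := (mxtens.mxtens_unindex k).

Section Operators.
Variable R : realType.
Local Notation C := (R[i]).

Definition ket d (i : 'I_d) : 'cV[C]_d := delta_mx i 0.

Definition unit_vector d (v : 'cV[C]_d) : Prop := (v^t* *m v) 0 0 = 1.

Definition ketbra d (v : 'cV[C]_d) : 'M[C]_d := v *m v^t*.

(* The order on R[i] makes [0 <= z] say that z is real and nonnegative, so that
   positive semidefinite operators are Hermitian. *)
Definition psd d (X : 'M[C]_d) : Prop :=
  forall v : 'cV[C]_d, 0 <= (v^t* *m X *m v) 0 0.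

(* F (x) G on operators of a bipartite system, by bilinear extension from the
   matrix units |i><j| (x) |k><l|. *)
Definition tensmap m n p q (F : 'M[C]_m -> 'M[C]_n) (G : 'M[C]_p -> 'M[C]_q)
    (X : 'M[C]_(m * p)) : 'M[C]_(n * q) :=
  \sum_(i < m) \sum_(j < m) \sum_(k < p) \sum_(l < p)
    X (mxpair i k) (mxpair j l) *: (F (delta_mx i j) *t G (delta_mx k l)).

Lemma tensmapE m n p q (F : {linear 'M[C]_m -> 'M[C]_n})
    (G : {linear 'M[C]_p -> 'M[C]_q}) (X : 'M[C]_m) (Y : 'M[C]_p) :
  tensmap F G (X *t Y) = F X *t G Y.
Proof.
rewrite [in RHS](matrix_sum_delta X) [in RHS](matrix_sum_delta Y).
rewrite !linear_sum /=; apply/matrixP => a b.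
rewrite !mxE !summxE mulr_suml; apply: eq_bigr => i _.
rewrite summxE linear_sum /= summxE mulr_suml; apply: eq_bigr => j _.
rewrite summxE mulr_sumr; apply: eq_bigr => k _.
rewrite summxE linear_sum /= summxE mulr_sumr; apply: eq_bigr => l _.
by rewrite !linearZ !mxE !mxtens.mxtens_indexK /= mulrACA.
Qed.

Definition completely_positive m n (F : 'M[C]_m -> 'M[C]_n) : Prop :=
  forall k (X : 'M[C]_(k * m)),
    psd X -> psd (tensmap (fun Y : 'M[C]_k => Y) F X).

Definition trace_preserving m n (F : 'M[C]_m -> 'M[C]_n) : Prop :=
  forall X, \tr (F X) = \tr X.

(* Reordering of the tensor factors, from A B A' B' to A A' B B'. *)
Definition shuffle_index a b a' b' (k : 'I_((a * a') * (b * b'))) :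
    'I_((a * b) * (a' * b')) :=
  let: (u, v) := mxunpair k in
  let: (i, i') := mxunpair u in
  let: (j, j') := mxunpair v in
  mxpair (mxpair i j) (mxpair i' j').

Definition shuffle a b a' b' (X : 'M[C]_((a * b) * (a' * b'))) :
    'M[C]_((a * a') * (b * b')) :=
  mxsub (@shuffle_index a b a' b') (@shuffle_index a b a' b') X.

Lemma shuffleE a b a' b' (X : 'M[C]_a) (Y : 'M[C]_b) (X' : 'M[C]_a')
    (Y' : 'M[C]_b') :
  shuffle ((X *t Y) *t (X' *t Y')) = (X *t X') *t (Y *t Y').
Proof.
apply/matrixP => k l.
case: (mxtens.mxtens_indexP k) => u v; case: (mxtens.mxtens_indexP u) => i i'.
case: (mxtens.mxtens_indexP v) => j j'.
case: (mxtens.mxtens_indexP l) => u2 v2.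
case: (mxtens.mxtens_indexP u2) => i2 i2'.
case: (mxtens.mxtens_indexP v2) => j2 j2'.
by rewrite mxE /shuffle_index !mxtens.mxtens_indexK !mxtens.tensmxE mulrACA.
Qed.

Definition ptrace2 m n (X : 'M[C]_(m * n)) : 'M[C]_m :=
  \matrix_(i, j) \sum_(k < n) X (mxpair i k) (mxpair j k).

(* Natural logarithm of a Hermitian operator by spectral calculus; as [ln 0 = 0],
   it vanishes on the kernel of a positive semidefinite operator, in accordance
   with the convention 0 log 0 = 0. *)
Definition mxln n (rho : 'M[C]_n) : 'M[C]_n :=
  invmx (spectralmx rho)
  *m diag_mx (map_mx (fun z : C => (ln (complex.Re z))%:C) (spectral_diag rho))
  *m spectralmx rho.

Definition von_neumann_entropy n (rho : 'M[C]_n) : R :=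
  - complex.Re (\tr (rho *m mxln rho)).

Definition entanglement_entropy m n (v : 'cV[C]_(m * n)) : R :=
  von_neumann_entropy (ptrace2 (ketbra v)).

(* Entrywise convergence; real and imaginary parts are taken separately. *)
Definition mx_cvg d (u : nat -> 'M[C]_d) (X : 'M[C]_d) : Prop :=
  forall i j,
    (fun n => complex.Re (u n i j)) @ \oo --> complex.Re (X i j) /\
    (fun n => complex.Im (u n i j)) @ \oo --> complex.Im (X i j).

End Operators.

Section TimeBin.
Variables (R : realType) (N : nat).
Local Notation C := (R[i]).

Definition timebin_ket (phi : R) (n : 'I_N.+1) : 'cV[C]_(N.+1 * N.+1) :=
  if n == ord0 then ket R ord0 *t ket R ord0
  else ((Num.sqrt 2)^-1)%:C *:
    (ket R n *t ket R ord0 + (cos phi +i* sin phi) *: (ket R ord0 *t ket R n)).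

Definition timebin_state phi n : 'M[C]_(N.+1 * N.+1) :=
  ketbra (timebin_ket phi n).

(* The shared randomness lambda ranges over nat, i.e. p is any discrete
   distribution; finitely many values correspond to p eventually 0. *)
Definition LOSE_instrument dA dB (rho : 'M[C]_(dA * dB))
    (L : 'I_N.+1 -> 'I_N.+1 ->
         'M[C]_(N.+1 * N.+1) -> 'M[C]_(N.+1 * N.+1)) : Prop :=
  exists (p : nat -> R)
         (A : nat -> 'I_N.+1 -> {linear 'M[C]_(N.+1 * dA) -> 'M[C]_N.+1})
         (B : nat -> 'I_N.+1 -> {linear 'M[C]_(N.+1 * dB) -> 'M[C]_N.+1}),
  [/\ (forall l, 0 <= p l) /\ series p @ \oo --> (1 : R),
      forall l x, completely_positive (A l x),
      forall l y, completely_positive (B l y),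
      (forall l, trace_preserving (fun X => \sum_x A l x X)) /\
      (forall l, trace_preserving (fun Y => \sum_y B l y Y))
    & forall x y Psi,
        mx_cvg (fun m => \sum_(l < m)
                  (p l)%:C *: tensmap (A l x) (B l y) (shuffle (Psi *t rho)))
               (L x y Psi)].

Definition register (x y : 'I_N.+1) : 'M[C]_(N.+1 * N.+1) :=
  ketbra (ket R x *t ket R y).

Definition instrument_output
    (L : 'I_N.+1 -> 'I_N.+1 -> 'M[C]_(N.+1 * N.+1) -> 'M[C]_(N.+1 * N.+1))
    (Psi : 'M[C]_(N.+1 * N.+1)) :
    'M[C]_((N.+1 * N.+1) * (N.+1 * N.+1)) :=
  \sum_x \sum_y L x y Psi *t register x y.

Definition implements_timebin_detection
    (L : 'I_N.+1 -> 'I_N.+1 ->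
         'M[C]_(N.+1 * N.+1) -> 'M[C]_(N.+1 * N.+1)) : Prop :=
  forall (n : 'I_N.+1) (phi : R), 0 <= phi < 2 * pi ->
  exists q : 'I_N.+1 -> 'I_N.+1 -> R,
  [/\ forall x y, 0 <= q x y,
      \sum_x \sum_y q x y = 1,
      forall x y : 'I_N.+1, (x + y != n %[mod N.+1])%N -> q x y = 0
    & instrument_output L (timebin_state phi n) =
      timebin_state phi n *t
        \sum_(x < N.+1) \sum_(y < N.+1 | (x + y == n %[mod N.+1])%N)
          (q x y)%:C *: register x y].

End TimeBin.

(* Main.v *)
Require Import Defs.
From HB Require Import structures.
From mathcomp Require Import all_boot all_order all_algebra.
From mathcomp Require Import complex.
From mathcomp Require Import all_classical all_reals all_analysis.
From mathcomp Require Import ring.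
Set Implicit Arguments.
Unset Strict Implicit.
Unset Printing Implicit Defensive.
Import Order.TTheory GRing.Theory Num.Theory.
Import numFieldNormedType.Exports.
Local Open Scope classical_set_scope.
Local Open Scope complex_scope.
Local Open Scope ring_scope.
Local Open Scope sesquilinear_scope.

(* Fix a value of the shared randomness of positive probability and decompose
   Alice's and Bob's maps into Kraus operators. Write a_x^{on} and b_y^{on} for
   their blocks <o|.|n>, functionals on A' and B', and M for the matrix of
   amplitudes of varphi, so that rho := varphi^{A'} is M times its adjoint.
   Mapping every Psi_{phi,n} to a multiple of itself forces, by comparing
   phi = 0, pi/2, pi, that a^{on} M b^{o'0} and a^{o0} M b^{o'n} vanish off the
   diagonal blocks, and that a_x^{nn} M b_y^{00} = a_x^{00} M b_y^{nn}, which is 0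
   unless x + y = n mod N+1. With the effects P^n_x = sum a^* a and
   Q^n_y = sum b b^*, completeness gives P^n_x M = M Q^0_{n-x} = P^0_{x-n} M, and
   coherence gives tr(P^n_x rho) = tr(P^0_x rho); hence tr(P^0_x rho) = 1/(N+1)
   for all x. The P^0_x act on the range of rho as orthogonal projectors commuting
   with rho, so each eigenvector of rho can be chosen in one of these N+1 blocks,
   and its eigenvalue is at most the trace of the block, 1/(N+1). A spectrum
   bounded by 1/(N+1) has entropy at least log(N+1). *)

(** * Adjoints, and the eigenvalue bound from measurement effects *)

Lemma adjmxM (C : numClosedFieldType) m n p (A : 'M[C]_(m, n)) (B : 'M[C]_(n, p)) :
  (A *m B)^t* = B^t* *m A^t*.
Proof. by rewrite trmx_mul map_mxM. Qed.

Lemma adjmx_sum (C : numClosedFieldType) (I : finType) m n (F : I -> 'M[C]_(m, n)) :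
  (\sum_i F i)^t* = \sum_i (F i)^t*.
Proof. by rewrite raddf_sum /= raddf_sum. Qed.

Lemma mxtrace_gram (C : numClosedFieldType) m n (Z : 'M[C]_(m, n)) :
  \tr (Z *m Z^t*) = \sum_i \sum_j `|Z i j| ^+ 2.
Proof.
apply: eq_bigr => i _; rewrite !mxE; apply: eq_bigr => j _.
by rewrite !mxE normCK.
Qed.

(** Cauchy-Schwarz for [u] against each column of [Z]; the squared column norms add up to the
    trace. *)
Lemma gram_le_mxtrace (C : numClosedFieldType) m n (u : 'rV[C]_m) (Z : 'M[C]_(m, n)) :
  (u *m (Z *m Z^t*) *m u^t*) 0 0 <= \tr (Z *m Z^t*) * (u *m u^t*) 0 0.
Proof.
have -> : u *m (Z *m Z^t*) *m u^t* = (u *m Z) *m (u *m Z)^t*.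
  by rewrite adjmxM !mulmxA.
rewrite mxtrace_gram exchange_big /= [leLHS]mxE mulr_suml; apply: ler_sum => j _.
have [+ _] := CauchySchwarz (@dotmx C m) u ((col j Z)^t*).
rewrite /= !dotmxE trmxCK mulrC.
have -> : (u *m col j Z) 0 0 = (u *m Z) 0 j.
  by rewrite !mxE; apply: eq_bigr => i _; rewrite mxE.
have -> : ((col j Z)^t* *m col j Z) 0 0 = \sum_(i < m) `|Z i j| ^+ 2.
  by rewrite mxE; apply: eq_bigr => i _; rewrite !mxE normCKC.
by rewrite normCK [((u *m Z)^t*) j 0]mxE [((u *m Z)^T) j 0]mxE.
Qed.

(** [P k x] and [Q k y] abstract the effects of Alice and Bob on the resource when their own system
    is in |k>; index arithmetic is modulo N+1. [PQ0] and [QP0] encode the support of the outcomes,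
    [PQ_sym] the coherence between the two places where the excitation can be. *)
Lemma effects_eigenvalue_le (C : numClosedFieldType) (N m n : nat) (M : 'M[C]_(m, n))
    (P : 'I_N.+1 -> 'I_N.+1 -> 'M[C]_m) (Q : 'I_N.+1 -> 'I_N.+1 -> 'M[C]_n)
    (P_complete : forall k, (\sum_x P k x) *m M = M)
    (Q_complete : forall k, M *m (\sum_y Q k y) = M)
    (P_herm : forall x, (P 0 x)^t* = P 0 x) (Q_herm : forall y, (Q 0 y)^t* = Q 0 y)
    (PQ0 : forall k x y, x + y != k -> P k x *m M *m Q 0 y = 0)
    (QP0 : forall k x y, x + y != k -> P 0 x *m M *m Q k y = 0)
    (PQ_sym : forall k x y, \tr (P k x *m M *m Q 0 y *m M^t*) =
                            \tr (P 0 x *m M *m Q k y *m M^t*))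
    (v : 'rV[C]_m) (lam : C) :
  v != 0 -> lam != 0 -> v *m (M *m M^t*) = lam *: v ->
  lam *+ N.+1 <= \tr (M *m M^t*).
Proof.
move=> v0 lam0 vE; set R := M *m M^t*.
(* Inserting Bob's complete family for input 0 leaves only the outcome [k - x] allowed by [PQ0]. *)
have PM k x : P k x *m M = P k x *m M *m Q 0 (k - x).
  rewrite -{1}(Q_complete 0) mulmx_sumr mulmx_sumr.
  rewrite (bigD1 (k - x)) //= big1 ?addr0 ?mulmxA // => y neq_y.
  by rewrite mulmxA PQ0 //; apply: contra neq_y => /eqP <-; rewrite addrAC subrr add0r.
have MQ k x : P k x *m M = M *m Q 0 (k - x).
  rewrite PM -[in RHS](P_complete k) mulmx_suml mulmx_suml.
  rewrite (bigD1 x) //= big1 ?addr0 // => y neq_y.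
  rewrite PQ0 //; apply: contra neq_y => /eqP kE; rewrite -subr_eq0.
  by apply/eqP/(addrI k); rewrite addr0 -[RHS]kE addrCA.
have PR0 x y : P 0 x *m M = P 0 x *m M *m Q y (y - x).
  rewrite -{1}(Q_complete y) mulmx_sumr mulmx_sumr.
  rewrite (bigD1 (y - x)) //= big1 ?addr0 ?mulmxA // => z neq_z.
  by rewrite mulmxA QP0 //; apply: contra neq_z => /eqP <-; rewrite addrAC subrr add0r.
have trP k x : \tr (P k x *m R) = \tr (P 0 x *m R).
  by rewrite !mulmxA (PM k) PQ_sym -PR0.
have trS k x : \tr (P k x *m R) = \tr (P 0 (x - k) *m R).
  by rewrite !mulmxA !MQ sub0r opprB.
(* [trP] at [k = x] passes from [P 0 x] to [P x x], and [trS] from there to outcome [x - x = 0]. *)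
have tr0 x : \tr (P 0 x *m R) = \tr (P 0 0 *m R).
  by rewrite -(trP x) trS subrr.
have PR : (\sum_x P 0 x) *m R = R by rewrite mulmxA P_complete.
have <- : \tr (P 0 0 *m R) *+ N.+1 = \tr R.
  rewrite -[in RHS]PR mulmx_suml raddf_sum /= (eq_bigr _ (fun x _ => tr0 x)).
  by rewrite sumr_const card_ord.
rewrite ler_wMn2r //.
have Radj : R^t* = R by rewrite adjmxM trmxCK.
(* By [MQ] the product [P 0 x *m R] is [M] times a Hermitian matrix times the adjoint of [M], hence
   self-adjoint; its adjoint is [R *m P 0 x]. *)
have Pcomm x : P 0 x *m R = R *m P 0 x.
  have E : P 0 x *m R = M *m Q 0 (0 - x) *m M^t* by rewrite mulmxA MQ.
  rewrite -[RHS]trmxCK adjmxM P_herm Radj E !adjmxM trmxCK Q_herm.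
  by rewrite !mulmxA.
(* Pushing one [P 0 x] through [M] turns it into a [Q 0], which [PM] absorbs. *)
have PP x : P 0 x *m (P 0 x *m R) = P 0 x *m R.
  by rewrite !mulmxA; congr (_ *m _); rewrite -mulmxA MQ mulmxA -PM.
have vP : \sum_x v *m P 0 x = v.
  apply: (scalerI lam0); rewrite -mulmx_sumr scalemxAl -vE -mulmxA; congr (_ *m _).
  by rewrite -[RHS]PR mulmx_suml mulmx_sumr; apply: eq_bigr => x _; rewrite Pcomm.
have [x u0] : exists x, v *m P 0 x != 0.
  case: (pickP (fun x => v *m P 0 x != 0)) => [x u0|u0]; first by exists x.
  by case/eqP: v0; rewrite -vP big1 // => x _; apply/eqP/negbFE/u0.
rewrite -(tr0 x); set u := v *m P 0 x in u0 *.
have uR : u *m R = lam *: u by rewrite -mulmxA Pcomm mulmxA vE -scalemxAl.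
have uP : u *m P 0 x = u.
  by apply: (scalerI lam0); rewrite scalemxAl -uR -mulmxA -Pcomm -!mulmxA PP.
have ZZ : (P 0 x *m M) *m (P 0 x *m M)^t* = P 0 x *m R *m P 0 x.
  by rewrite adjmxM P_herm !mulmxA.
(* As [u] is an eigenvector fixed by [P 0 x], the left side is [lam] times its squared norm, and the
   trace on the right is the weight of a single block. *)
have := gram_le_mxtrace u (P 0 x *m M); rewrite ZZ.
have -> : \tr (P 0 x *m R *m P 0 x) = \tr (P 0 x *m R).
  by rewrite mxtrace_mulC PP.
have -> : (u *m (P 0 x *m R *m P 0 x) *m u^t*) = lam *: (u *m u^t*).
  rewrite (mulmxA u) (mulmxA u (P 0 x)) uP uR -!scalemxAl -mulmxA.
  by rewrite -[in LHS](P_herm x) -adjmxM uP.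
have uu : 0 < (u *m u^t*) 0 0.
  by rewrite -dotmxE; have := @dnorm_gt0 _ _ (@dotmx C m) u; rewrite u0.
by rewrite mxE ler_pM2r.
Qed.

(** The effects are built from the diagonal blocks alone: off-diagonal blocks vanish against [M], so
    completeness still holds when applied to [M]. *)
Lemma kraus_eigenvalue_le (C : numClosedFieldType) (N m n k l : nat) (M : 'M[C]_(m, n))
    (a : 'I_N.+1 -> 'I_k -> 'I_N.+1 -> 'I_N.+1 -> 'rV[C]_m)
    (b : 'I_N.+1 -> 'I_l -> 'I_N.+1 -> 'I_N.+1 -> 'cV[C]_n)
    (a_complete : forall i,
      \sum_x \sum_r \sum_o (a x r o i)^t* *m a x r o i = 1%:M)
    (b_complete : forall i,
      \sum_y \sum_s \sum_o b y s o i *m (b y s o i)^t* = 1%:M)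
    (ab_off : forall x r y s i o o', (o, o') != (i, 0) ->
      a x r o i *m M *m b y s o' 0 = 0)
    (ba_off : forall x r y s i o o', (o, o') != (0, i) ->
      a x r o 0 *m M *m b y s o' i = 0)
    (ab_outcome : forall x r y s i, x + y != i -> a x r i i *m M *m b y s 0 0 = 0)
    (ab_sym : forall x r y s i,
      a x r i i *m M *m b y s 0 0 = a x r 0 0 *m M *m b y s i i)
    (v : 'rV[C]_m) (lam : C) :
  v != 0 -> lam != 0 -> v *m (M *m M^t*) = lam *: v ->
  lam *+ N.+1 <= \tr (M *m M^t*).
Proof.
pose P i x := \sum_r (a x r i i)^t* *m a x r i i.
pose Q i y := \sum_s b y s i i *m (b y s i i)^t*.
(* Bob's completeness relation for input 0 inserts an identity, and each resulting term contains an
   off-diagonal amplitude. *)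
have aM0 x r o i : o != i -> a x r o i *m M = 0.
  move=> oi; rewrite -[LHS]mulmx1 -(b_complete 0) mulmx_sumr big1 // => y _.
  rewrite mulmx_sumr big1 // => s _; rewrite mulmx_sumr big1 // => o' _.
  by rewrite mulmxA ab_off ?mul0mx // xpair_eqE (negPf oi).
have Mb0 y s o i : o != i -> M *m b y s o i = 0.
  move=> oi; rewrite -[LHS]mul1mx -(a_complete 0) mulmx_suml big1 // => x _.
  rewrite mulmx_suml big1 // => r _; rewrite mulmx_suml big1 // => o' _.
  by rewrite -mulmxA (mulmxA (a _ _ _ _)) ba_off ?mulmx0 // xpair_eqE (negPf oi) andbF.
have PMQ i j x y : P i x *m M *m Q j y = \sum_r \sum_s
    (a x r i i)^t* *m (a x r i i *m M *m b y s j j) *m (b y s j j)^t*.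
  rewrite /P /Q 2!mulmx_suml; apply: eq_bigr => r _.
  by rewrite mulmx_sumr; apply: eq_bigr => s _; rewrite !mulmxA.
apply: (effects_eigenvalue_le (P := P) (Q := Q)) => [i|i|x|y|i x y xyi|i x y xyi|i x y].
- rewrite -[RHS]mul1mx -(a_complete i) !mulmx_suml; apply: eq_bigr => x _.
  rewrite !mulmx_suml; apply: eq_bigr => r _.
  rewrite [in RHS](bigD1 i) //= mulmxDl mulmx_suml big1 ?addr0 // => o oi.
  by rewrite -mulmxA aM0 ?mulmx0.
- rewrite -[RHS]mulmx1 -(b_complete i) !mulmx_sumr; apply: eq_bigr => y _.
  rewrite !mulmx_sumr; apply: eq_bigr => s _.
  rewrite [in RHS](bigD1 i) //= mulmxDr mulmx_sumr big1 ?addr0 // => o oi.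
  by rewrite mulmxA Mb0 ?mul0mx.
- by rewrite adjmx_sum; apply: eq_bigr => r _; rewrite adjmxM trmxCK.
- by rewrite adjmx_sum; apply: eq_bigr => s _; rewrite adjmxM trmxCK.
- rewrite PMQ big1 // => r _; rewrite big1 // => s _.
  by rewrite ab_outcome ?mulmx0 ?mul0mx.
- rewrite PMQ big1 // => r _; rewrite big1 // => s _.
  by rewrite -ab_sym ab_outcome ?mulmx0 ?mul0mx.
- rewrite !PMQ !mulmx_suml !raddf_sum; apply: eq_bigr => r _ /=.
  rewrite !mulmx_suml !raddf_sum; apply: eq_bigr => s _ /=.
  (* Each trace is a squared modulus of an amplitude, to which [ab_sym] applies. *)
  have tr_norm (c : 'rV[C]_m) (d : 'cV[C]_n) :
      \tr (c^t* *m (c *m M *m d) *m d^t* *m M^t*) = \tr ((c *m M *m d) *m (c *m M *m d)^t*).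
    by rewrite -!mulmxA mxtrace_mulC !adjmxM !mulmxA.
  by rewrite !tr_norm ab_sym.
Qed.

(** * Entropy of a bounded spectrum *)

Lemma ler_ln_entropy (R : realType) (m n d : nat) (M : 'M[R[i]]_(m, n)) :
  (0 < d)%N -> \tr (M *m M^t*) = 1 ->
  (forall (v : 'rV_m) lam, v != 0 -> lam != 0 -> v *m (M *m M^t*) = lam *: v ->
    lam *+ d <= 1) ->
  ln d%:R <= von_neumann_entropy (M *m M^t*).
Proof.
move=> d_gt0 trM eig; set rho := M *m M^t* in trM eig *.
set U := spectralmx rho; set D := spectral_diag rho.
have Uunit : U \in unitmx by exact: spectral_unit.
have UU : U *m U^t* = 1%:M by apply/unitarymxP/spectral_unitarymx.
have rhoE : rho = invmx U *m diag_mx D *m U.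
  by apply/orthomx_spectralP/normalmxP; rewrite adjmxM trmxCK.
have UrhoE : U *m rho = diag_mx D *m U.
  by rewrite rhoE -!mulmxA mulKVmx.
(* The rows of [U] are left eigenvectors of [rho], the form in which [eig] takes them. *)
have rowU k : row k U *m rho = D 0 k *: row k U.
  rewrite -row_mul UrhoE; apply/rowP => j.
  by rewrite !mxE (bigD1 k) //= big1 ?addr0 ?mxE ?eqxx // => i /negPf ik;
    rewrite mxE eq_sym ik mul0r.
have rowU0 k : row k U != 0.
  apply/eqP => Uk0; have /(congr1 (row k)) := UU.
  rewrite row_mul Uk0 mul0mx => /rowP/(_ k); rewrite !mxE eqxx => /eqP.
  by rewrite eq_sym oner_eq0.
have D_ge0 k : 0 <= D 0 k.
  have : (diag_mx D) k k = (U *m M *m (U *m M)^t*) k k.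
    rewrite adjmxM mulmxA -(mulmxA U) -/rho UrhoE.
    by rewrite -mulmxA UU mulmx1.
  rewrite mxE eqxx mulr1n => ->; rewrite mxE sumr_ge0 // => j _.
  by rewrite !mxE mul_conjC_ge0.
pose r k := complex.Re (D 0 k).
have DE k : D 0 k = (r k)%:C by rewrite RRe_real // ger0_real.
have r_ge0 k : 0 <= r k by have := D_ge0 k; rewrite DE ler0c.
have sum_r : \sum_k r k = 1.
  apply: (@complexI R); rewrite rmorph_sum rmorph1 -trM rhoE mxtrace_mulC.
  rewrite mulKVmx // mxtrace_diag; apply: eq_bigr => k _; exact/esym/DE.
have r_le k : r k != 0 -> r k <= d%:R^-1.
  move=> rk0; have Dk0 : D 0 k != 0 by rewrite DE eq_complex /= eqxx andbT.
  have := eig _ _ (rowU0 k) Dk0 (rowU k).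
  have -> : D 0 k *+ d = (r k *+ d)%:C by rewrite rmorphMn /= -DE.
  rewrite (lecR _ 1) => drk; rewrite -[leRHS]mul1r ler_pdivlMr ?ltr0n //.
  by rewrite mulr_natr.
rewrite /von_neumann_entropy /mxln -/U -/D.
have -> : \tr (rho *m (invmx U *m diag_mx (map_mx
    (fun z => (ln (complex.Re z))%:C) D) *m U)) = (\sum_k r k * ln (r k))%:C.
  rewrite {1}rhoE !mulmxA mulmxK // mxtrace_mulC !mulmxA mulmxV // mul1mx.
  rewrite mulmx_diag mxtrace_diag rmorph_sum; apply: eq_bigr => k _.
  by rewrite !mxE rmorphM /= -DE.
(* [ln d] is written as its own average under the distribution [r], so the comparison is termwise; a
   zero eigenvalue gives 0 on both sides. *)
rewrite /= -sumrN -[leLHS]mul1r -[X in X * _ <= _]sum_r mulr_suml; apply: ler_sum => k _.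
have [->|rk0] := eqVneq (r k) 0; first by rewrite !mul0r oppr0.
have rk_gt0 : 0 < r k by rewrite lt_neqAle eq_sym rk0 r_ge0.
rewrite -mulrN ler_wpM2l // lerNr -lnV ?posrE ?ltr0n //.
by rewrite ler_ln ?posrE ?invr_gt0 ?ltr0n // r_le.
Qed.

(** * Positive semidefinite matrices and Kraus decompositions *)

Lemma form_delta (C : numClosedFieldType) m n (A : 'M[C]_(m, n)) i j :
  ((delta_mx i 0 : 'cV_m)^t* *m A *m (delta_mx j 0 : 'cV_n)) 0 0 = A i j.
Proof.
rewrite trmx_delta map_delta_mx -rowE -colE.
by rewrite !mxE.
Qed.

(** Polarization on e_i + c e_j: [c = 1] makes the two off-diagonal entries opposite, [c = 'i] makes
    them equal. *)
Lemma form_eq0 (C : numClosedFieldType) n (B : 'M[C]_n) :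
  (forall v : 'cV_n, (v^t* *m B *m v) 0 0 = 0) -> B = 0.
Proof.
move=> formB.
have expand c i j : B i i + c * B i j + (c^* * B j i + c^* * c * B j j) = 0.
  have := formB (delta_mx i 0 + c *: delta_mx j 0).
  have -> : (delta_mx i 0 + c *: delta_mx j 0)^t* =
      (delta_mx i 0 : 'cV_n)^t* + c^* *: (delta_mx j 0 : 'cV_n)^t*.
    by apply/matrixP => a b; rewrite !mxE rmorphD rmorphM.
  have entryD (X Y : 'M[C]_1) : (X + Y) 0 0 = X 0 0 + Y 0 0 by rewrite mxE.
  have entryZ d (X : 'M[C]_1) : (d *: X) 0 0 = d * X 0 0 by rewrite mxE.
  rewrite !(mulmxDl, mulmxDr) -!(scalemxAl, scalemxAr) !(entryD, entryZ) !form_delta => <-.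
  by rewrite -!mulrA addrACA.
have Bii i : B i i = 0 by rewrite -form_delta formB.
apply/matrixP => i j; rewrite [RHS]mxE.
have := expand 'i i j; have := expand 1 i j.
rewrite !Bii conjCi rmorph1 !mul1r !mulr0 !add0r !addr0 mulNr.
move=> BijE /eqP; rewrite subr_eq0 => /eqP/(mulfI (neq0Ci _)) Bji.
by move/eqP: BijE; rewrite -Bji -mulr2n mulrn_eq0 /= => /eqP.
Qed.

Lemma psd_hermitian (R : realType) n (A : 'M[R[i]]_n) : psd A -> A^t* = A.
Proof.
move=> psdA; apply/esym/subr0_eq/form_eq0 => v.
rewrite mulmxBr mulmxBl.
have -> : v^t* *m A^t* *m v = (v^t* *m A *m v)^t*.
  by rewrite !adjmxM trmxCK mulmxA.
have := ger0_real (psdA v); move: (v^t* *m A *m v) => X /CrealP Xreal.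
by rewrite !mxE Xreal subrr.
Qed.

Lemma psd_gram (R : realType) n (A : 'M[R[i]]_n) :
  psd A -> exists Z : 'M[R[i]]_n, A = Z^t* *m Z.
Proof.
move=> psdA; set U := spectralmx A; set D := spectral_diag A.
have Uunit : U \in unitmx by exact: spectral_unit.
have UU : U *m U^t* = 1%:M by apply/unitarymxP/spectral_unitarymx.
have AE : A = U^t* *m diag_mx D *m U.
  rewrite -invmx_unitary ?spectral_unitarymx //.
  by apply/orthomx_spectralP/normalmxP; rewrite psd_hermitian.
have D_ge0 k : 0 <= D 0 k.
  (* This vector is the k-th eigenvector, so the form there is the k-th eigenvalue. *)
  have := psdA (U^t* *m delta_mx k 0).
  rewrite adjmxM trmxCK AE -!mulmxA (mulmxA U (U^t* )) UU mul1mx.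
  rewrite (mulmxA U (U^t* )) UU mul1mx mulmxA form_delta.
  by rewrite mxE eqxx.
exists (diag_mx (map_mx sqrtC D) *m U).
rewrite adjmxM {1}AE -!mulmxA; congr (_ *m _).
rewrite tr_diag_mx map_diag_mx mulmxA mulmx_diag; congr (diag_mx _ *m _).
apply/rowP => k; rewrite !mxE.
by rewrite /= geC0_conj ?sqrtC_ge0 // -expr2 sqrtCK.
Qed.

(** [Omega] is the unnormalized maximally entangled operator, so the left side is an entry of the
    Choi matrix of [F]. *)
Lemma tensmap_id_maxent (R : realType) m n (F : 'M[R[i]]_m -> 'M[R[i]]_n)
    (Omega : 'M[R[i]]_(m * m))
    (OmegaE : forall i k j l, Omega (mxpair i k) (mxpair j l) = ((i == k) && (j == l))%:R)
    k l a b :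
  tensmap (fun Y : 'M[R[i]]_m => Y) F Omega (mxpair k a) (mxpair l b) = F (delta_mx k l) a b.
Proof.
have termE i j k' l' : (Omega (mxpair i k') (mxpair j l') *:
    ((delta_mx i j : 'M[R[i]]_m) *t F (delta_mx k' l'))) (mxpair k a) (mxpair l b) =
    ((i == k') && (j == l'))%:R * (((k == i) && (l == j))%:R * F (delta_mx k' l') a b).
  by rewrite mxE mxtens.tensmxE OmegaE mxE.
rewrite /tensmap summxE (bigD1 k) //= [X in _ + X]big1 ?addr0 => [|i ik]; last first.
  rewrite summxE big1 // => j _; rewrite summxE big1 // => k' _; rewrite summxE big1 // => l' _.
  by rewrite termE (eq_sym k) (negPf ik) mul0r mulr0.
rewrite summxE (bigD1 l) //= [X in _ + X]big1 ?addr0 => [|j jl]; last first.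
  rewrite summxE big1 // => k' _; rewrite summxE big1 // => l' _.
  by rewrite termE (eq_sym l) (negPf jl) andbF mul0r mulr0.
rewrite summxE (bigD1 k) //= [X in _ + X]big1 ?addr0 => [|k' k'k]; last first.
  rewrite summxE big1 // => l' _.
  by rewrite termE (eq_sym k k') (negPf k'k) mul0r.
rewrite summxE (bigD1 l) //= [X in _ + X]big1 ?addr0 => [|l' l'l]; last first.
  by rewrite termE (eq_sym l l') (negPf l'l) andbF mul0r.
by rewrite termE !eqxx !mul1r.
Qed.

Lemma psd_ketbra (R : realType) n (v : 'cV[R[i]]_n) : psd (ketbra v).
Proof.
move=> u; rewrite /ketbra mulmxA -mulmxA.
have -> : v^t* *m u = (u^t* *m v)^t* by rewrite adjmxM trmxCK.
by rewrite mxE big_ord1 [X in _ * X]mxE [X in _ * Num.conj X]mxE mul_conjC_ge0.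
Qed.

(** Choi's argument: complete positivity makes the Choi matrix positive semidefinite, and the rows
    of its Gram factor, conjugated and reshaped, are Kraus operators. *)
Lemma completely_positive_kraus (R : realType) m n
    (F : {linear 'M[R[i]]_m -> 'M[R[i]]_n}) : completely_positive F ->
  exists K : 'I_(m * n) -> 'M[R[i]]_(n, m),
    forall X, F X = \sum_r K r *m X *m (K r)^t*.
Proof.
pose w : 'cV[R[i]]_(m * m) :=
  \col_k ((mxtens.mxtens_unindex k).1 == (mxtens.mxtens_unindex k).2)%:R.
move=> /(_ m _ (psd_ketbra w)) /psd_gram [Z ZE].
have FE k l a b : F (delta_mx k l) a b = (Z^t* *m Z) (mxpair k a) (mxpair l b).
  rewrite -ZE tensmap_id_maxent // => i k' j l'.
  by rewrite mxE big_ord1 !mxE !mxtens.mxtens_indexK /= rmorph_nat -natrM mulnb.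
exists (fun r => \matrix_(a, k) (Z r (mxpair k a))^*) => X.
apply/matrixP => a b.
transitivity (\sum_k \sum_l \sum_r X k l * ((Z r (mxpair k a))^* * Z r (mxpair l b))).
  rewrite [in LHS](matrix_sum_delta X) linear_sum summxE; apply: eq_bigr => k _.
  rewrite linear_sum summxE; apply: eq_bigr => l _.
  rewrite linearZ mxE FE mxE mulr_sumr; apply: eq_bigr => r _.
  by rewrite !mxE.
rewrite summxE; under eq_bigr do rewrite exchange_big /=.
rewrite exchange_big /=; apply: eq_bigr => r _.
rewrite exchange_big mxE; apply: eq_bigr => l _.
rewrite mxE mulr_suml; apply: eq_bigr => k _.
by rewrite !mxE conjCK mulrCA mulrA.
Qed.

(** * Kraus operators on tensor products *)

Lemma sum_mxpair (V : zmodType) m n (F : 'I_(m * n) -> V) :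
  \sum_k F k = \sum_i \sum_j F (mxpair i j).
Proof.
rewrite pair_big /= (reindex (@mxtens.mxtens_index m n)) /=; last first.
  exists (@mxtens.mxtens_unindex m n) => p _; first exact: mxtens.mxtens_indexK.
  exact: mxtens.mxtens_unindexK.
by apply: eq_bigr => -[i j].
Qed.

Lemma tensmx_suml (R : pzRingType) (I : finType) m n p q (F : I -> 'M[R]_(m, n))
    (Y : 'M[R]_(p, q)) : (\sum_i F i) *t Y = \sum_i F i *t Y.
Proof.
apply/matrixP => a b; rewrite summxE mxE summxE mulr_suml.
by apply: eq_bigr => i _; rewrite mxE.
Qed.

Lemma tensmx_sumr (R : pzRingType) (I : finType) m n p q (X : 'M[R]_(m, n))
    (F : I -> 'M[R]_(p, q)) : X *t (\sum_i F i) = \sum_i X *t F i.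
Proof.
apply/matrixP => a b; rewrite summxE mxE summxE mulr_sumr.
by apply: eq_bigr => i _; rewrite mxE.
Qed.

Lemma adjmx_tens (C : numClosedFieldType) m n p q (X : 'M[C]_(m, n)) (Y : 'M[C]_(p, q)) :
  (X *t Y)^t* = X^t* *t Y^t*.
Proof. by apply/matrixP => i j; rewrite !mxE rmorphM. Qed.

Lemma tensmx_sum_delta (R : pzRingType) m n (X : 'M[R]_(m * n)) :
  X = \sum_i \sum_j \sum_k \sum_l
    X (mxpair i k) (mxpair j l) *: ((delta_mx i j : 'M[R]_m) *t (delta_mx k l : 'M[R]_n)).
Proof.
rewrite [LHS]matrix_sum_delta sum_mxpair; apply: eq_bigr => i _.
under eq_bigr do rewrite sum_mxpair.
rewrite exchange_big; apply: eq_bigr => j _; apply: eq_bigr => k _; apply: eq_bigr => l _.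
congr (_ *: _); apply/matrixP => a b.
case: (mxtens.mxtens_indexP a) => a1 a2; case: (mxtens.mxtens_indexP b) => b1 b2.
rewrite mxtens.tensmxE !mxE -natrM mulnb !(can_eq (@mxtens.mxtens_indexK _ _)) !xpair_eqE.
by rewrite andbACA.
Qed.

(** Both sides are linear in [X], so agreement on tensor products of matrix units suffices. *)
Lemma tensmap_kraus (R : realType) m n p q (I J : finType)
    (F : 'M[R[i]]_m -> 'M[R[i]]_n) (G : 'M[R[i]]_p -> 'M[R[i]]_q)
    (K : I -> 'M[R[i]]_(n, m)) (H : J -> 'M[R[i]]_(q, p)) :
  (forall X, F X = \sum_r K r *m X *m (K r)^t*) ->
  (forall X, G X = \sum_s H s *m X *m (H s)^t*) ->
  forall X, tensmap F G X =
    \sum_r \sum_s (K r *t H s) *m X *m (K r *t H s)^t*.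
Proof.
move=> FE GE X.
have termE i j k l : F (delta_mx i j) *t G (delta_mx k l) = \sum_r \sum_s
    (K r *t H s) *m (delta_mx i j *t delta_mx k l) *m (K r *t H s)^t*.
  rewrite FE GE tensmx_suml; apply: eq_bigr => r _.
  rewrite tensmx_sumr; apply: eq_bigr => s _.
  by rewrite adjmx_tens !mxtens.tensmx_mul.
pose T (Y : 'M[R[i]]_(m * p)) : 'M[R[i]]_(n * q) :=
  \sum_r \sum_s (K r *t H s) *m Y *m (K r *t H s)^t*.
have TD Y Z : T (Y + Z) = T Y + T Z.
  rewrite /T -big_split; apply: eq_bigr => r _ /=; rewrite -big_split.
  by apply: eq_bigr => s _ /=; rewrite mulmxDr mulmxDl.
have T0 : T 0 = 0.
  by rewrite /T big1 // => r _; rewrite big1 // => s _; rewrite mulmx0 mul0mx.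
have TZ c Y : T (c *: Y) = c *: T Y.
  rewrite /T scaler_sumr; apply: eq_bigr => r _; rewrite scaler_sumr.
  by apply: eq_bigr => s _; rewrite -scalemxAr -scalemxAl.
have Tsum k (Y : 'I_k -> _) : T (\sum_i Y i) = \sum_i T (Y i) by exact: (big_morph T TD T0).
rewrite -/(T X) [in RHS](tensmx_sum_delta X) Tsum; apply: eq_bigr => i _.
rewrite Tsum; apply: eq_bigr => j _; rewrite Tsum; apply: eq_bigr => k _.
by rewrite Tsum; apply: eq_bigr => l _; rewrite TZ termE.
Qed.

(** Vector counterpart of [shuffle]: the input stays pure, so amplitudes can be compared instead of
    density matrices. *)
Definition shuffle_ket (R : realType) a b a' b' (v : 'cV[R[i]]_(a * b))
    (w : 'cV[R[i]]_(a' * b')) : 'cV[R[i]]_((a * a') * (b * b')) :=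
  \col_k (v (mxtens.mxtens_unindex (shuffle_index k)).1 0 *
          w (mxtens.mxtens_unindex (shuffle_index k)).2 0).

Lemma shuffle_ketE (R : realType) a b a' b' (v : 'cV[R[i]]_(a * b))
    (w : 'cV[R[i]]_(a' * b')) i i' j j' :
  shuffle_ket v w (mxpair (mxpair i i') (mxpair j j')) 0 =
  v (mxpair i j) 0 * w (mxpair i' j') 0.
Proof. by rewrite mxE /shuffle_index !mxtens.mxtens_indexK. Qed.

Lemma shuffle_ketbra (R : realType) a b a' b' (v : 'cV[R[i]]_(a * b))
    (w : 'cV[R[i]]_(a' * b')) :
  shuffle (ketbra v *t ketbra w) = ketbra (shuffle_ket v w).
Proof.
apply/matrixP => k l.
rewrite [LHS]mxE [LHS]mxE ![(ketbra _) _ _]mxE !big_ord1 !mxE rmorphM.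
by rewrite mulrACA.
Qed.

(** The block <o|K|i>, a functional on the party's share of the resource. *)
Definition kraus_row (R : realType) d e (K : 'M[R[i]]_(d, d * e)) (o i : 'I_d) : 'rV[R[i]]_e :=
  \row_j K o (mxpair i j).

(** Reshaping [w] into a matrix turns the contraction over both shares of the resource into row
    times matrix times column. *)
Lemma kraus_shuffle_ket (R : realType) d e e' (K : 'M[R[i]]_(d, d * e))
    (H : 'M[R[i]]_(d, d * e')) (v : 'cV[R[i]]_(d * d)) (w : 'cV[R[i]]_(e * e')) o o' :
  ((K *t H) *m shuffle_ket v w) (mxpair o o') 0 =
  \sum_i \sum_i' v (mxpair i i') 0 *
    (kraus_row K o i *m (\matrix_(j, j') w (mxpair j j') 0) *m (kraus_row H o' i')^T) 0 0.
Proof.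
rewrite mxE sum_mxpair sum_mxpair; apply: eq_bigr => i _.
under eq_bigr do rewrite sum_mxpair.
rewrite exchange_big; apply: eq_bigr => i' _.
rewrite [in RHS]mxE mulr_sumr exchange_big; apply: eq_bigr => j' _ /=.
rewrite [in RHS]mxE mulr_suml mulr_sumr; apply: eq_bigr => j _.
rewrite mxtens.tensmxE shuffle_ketE !mxE.
by rewrite [in RHS]mulrAC [RHS]mulrCA.
Qed.

(** * Isolating one value of the shared randomness *)

Lemma mx_cvg_form (R : realType) d (T : nat -> 'M[R[i]]_d) (X : 'M[R[i]]_d) (u : 'cV[R[i]]_d) :
  mx_cvg T X ->
  (fun m => complex.Re ((u^t* *m T m *m u) 0 0)) @ \oo --> complex.Re ((u^t* *m X *m u) 0 0).
Proof.
move=> cvgT.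
have formE (Y : 'M[R[i]]_d) : complex.Re ((u^t* *m Y *m u) 0 0) =
    \sum_j \sum_i (complex.Re (Y i j) * complex.Re ((u i 0)^* * u j 0)
                 - complex.Im (Y i j) * complex.Im ((u i 0)^* * u j 0)).
  rewrite mxE raddf_sum; apply: eq_bigr => j _.
  rewrite mxE mulr_suml raddf_sum; apply: eq_bigr => i _.
  rewrite !mxE -mulrA mulrCA.
  by case: (Y i j) => a b; case: ((u i 0)^* * u j 0) => c e.
rewrite formE; under eq_fun do rewrite formE.
apply: cvg_big => //; first exact: add_continuous.
move=> j _; apply: cvg_big => //; first exact: add_continuous.
move=> i _; have [cvgRe cvgIm] := cvgT i j.
by apply: cvgB; apply: cvgMr_tmp.
Qed.

(** The terms of the form are nonnegative, so the partial sums increase to the limit 0 and every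
    term vanishes; a positive weight can then be cancelled. *)
Lemma psd_series_form_eq0 (R : realType) d (p : nat -> R) (T : nat -> 'M[R[i]]_d)
    (X : 'M[R[i]]_d) (u : 'cV[R[i]]_d) :
  (forall l, 0 <= p l) -> (forall l, psd (T l)) ->
  mx_cvg (fun m => \sum_(l < m) (p l)%:C *: T l) X ->
  (u^t* *m X *m u) 0 0 = 0 ->
  forall l, 0 < p l -> (u^t* *m T l *m u) 0 0 = 0.
Proof.
move=> p_ge0 psdT /mx_cvg_form - /(_ u) + uXu; rewrite uXu raddf0 => cvgT l pl.
pose t k := p k * complex.Re ((u^t* *m T k *m u) 0 0).
have formE k : (u^t* *m T k *m u) 0 0 = (complex.Re ((u^t* *m T k *m u) 0 0))%:C.
  by rewrite RRe_real // ger0_real //; apply: psdT.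
have t_ge0 k : 0 <= t k.
  by rewrite mulr_ge0 // -ler0c -formE; apply: psdT.
have seriesE : (fun m => complex.Re ((u^t* *m (\sum_(l < m) (p l)%:C *: T l) *m u) 0 0)) = series t.
  apply/funext => m; rewrite /series /= big_mkord mulmx_sumr mulmx_suml summxE raddf_sum.
  apply: eq_bigr => k _; rewrite -scalemxAr -scalemxAl mxE /t formE.
  by rewrite -rmorphM.
rewrite seriesE in cvgT.
have := nondecreasing_cvgn_le (u_ := series t).
have nd : nondecreasing_seq (series t).
  by apply/nondecreasing_seqP => m; rewrite /series /= big_nat_recr //= lerDl.
move=> /(_ nd (cvgP _ cvgT) l.+1); rewrite (cvg_lim _ cvgT) //.
rewrite /series /= big_nat_recr //= => le0.
have {le0} : t l <= 0.
  by apply: le_trans le0; rewrite lerDr sumr_ge0.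
rewrite /t pmulr_rle0 // => Re_le0.
have := psdT l u; rewrite formE ler0c => Re_ge0.
by congr (_%:C); apply/eqP; rewrite eq_le Re_le0.
Qed.

(** * Outputs of the instrument on time-bin states *)

Lemma register_diagE (R : realType) N (x y x' y' : 'I_N.+1) :
  register R x' y' (mxpair x y) (mxpair x y) = ((x == x') && (y == y'))%:R.
Proof.
rewrite mxE big_ord1 !mxE !mxtens.mxtens_indexK /= !andbT.
by rewrite rmorphM !rmorph_nat -!natrM !mulnb andbb.
Qed.

(** The register states are orthogonal, so the diagonal register block at [(x, y)] isolates [L x y].
    Addition in ['I_N.+1] is already modulo N+1. *)
Lemma implements_output (R : realType) N
    (L : 'I_N.+1 -> 'I_N.+1 -> 'M[R[i]]_(N.+1 * N.+1) -> 'M[R[i]]_(N.+1 * N.+1)) :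
  implements_timebin_detection L ->
  forall n phi x y, 0 <= phi < 2 * pi ->
  exists2 c : R[i], L x y (timebin_state phi n) = c *: timebin_state phi n &
    x + y != n -> c = 0.
Proof.
move=> implL n phi x y /(implL n) [q [_ _ q0 outE]].
have condE : (x + y == n %[mod N.+1])%N = (x + y == n).
  by rewrite -val_eqE /= (modn_small (ltn_ord n)).
exists (if x + y == n then (q x y)%:C else 0); last by move=> /negPf ->.
apply/matrixP => a b.
have := congr1 (fun Y : 'M[R[i]]_(_) => Y (mxpair a (mxpair x y)) (mxpair b (mxpair x y))) outE.
rewrite mxtens.tensmxE.
have -> : instrument_output L (timebin_state phi n)
    (mxpair a (mxpair x y)) (mxpair b (mxpair x y)) = L x y (timebin_state phi n) a b.
  rewrite summxE (bigD1 x) //= [X in _ + X]big1 ?addr0 => [|x' x'x]; last first.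
    rewrite summxE big1 // => y' _.
    by rewrite mxtens.tensmxE register_diagE (eq_sym x) (negPf x'x) mulr0.
  rewrite summxE (bigD1 y) //= [X in _ + X]big1 ?addr0 => [|y' y'y]; last first.
    by rewrite mxtens.tensmxE register_diagE (eq_sym y) (negPf y'y) andbF mulr0.
  by rewrite mxtens.tensmxE register_diagE !eqxx mulr1.
move=> ->; rewrite [RHS]mxE [RHS]mulrC; congr (_ * _).
rewrite summxE (bigD1 x) //= [X in _ + X]big1 ?addr0 => [|x' x'x]; last first.
  rewrite summxE big1 // => y' _.
  by rewrite mxE register_diagE (eq_sym x) (negPf x'x) mulr0.
rewrite -condE summxE big_mkcond (bigD1 y) //= [X in _ + X]big1 ?addr0 => [|y' y'y]; last first.
  case: ifP => // _.
  by rewrite mxE register_diagE (eq_sym y) (negPf y'y) andbF mulr0.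
by case: ifP => // _; rewrite mxE register_diagE !eqxx mulr1.
Qed.

(** The form is a sum of squared moduli, one for each pair of Kraus operators. *)
Lemma kraus_kernel (R : realType) m n (I J : finType) p q
    (K : I -> 'M[R[i]]_(n, m)) (H : J -> 'M[R[i]]_(q, p)) (w : 'cV[R[i]]_(m * p))
    (u : 'cV[R[i]]_(n * q)) :
  (u^t* *m (\sum_r \sum_s (K r *t H s) *m ketbra w *m (K r *t H s)^t*) *m u) 0 0 = 0 ->
  forall r s, (u^t* *m ((K r *t H s) *m w)) 0 0 = 0.
Proof.
pose c r s := (u^t* *m ((K r *t H s) *m w)) 0 0.
have -> : (u^t* *m (\sum_r \sum_s (K r *t H s) *m ketbra w *m (K r *t H s)^t*) *m u) 0 0 =
    \sum_r \sum_s `|c r s| ^+ 2.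
  rewrite mulmx_sumr mulmx_suml summxE; apply: eq_bigr => r _.
  rewrite mulmx_sumr mulmx_suml summxE; apply: eq_bigr => s _.
  have -> : u^t* *m ((K r *t H s) *m ketbra w *m (K r *t H s)^t*) *m u =
      (u^t* *m ((K r *t H s) *m w)) *m (u^t* *m ((K r *t H s) *m w))^t*.
    by rewrite /ketbra !adjmxM trmxCK !mulmxA.
  by rewrite [LHS]mxE big_ord1 [X in _ * X]mxE [X in _ * Num.conj X]mxE normCK.
move=> sum0 r s.
have sum_ge0 r' : 0 <= \sum_s `|c r' s| ^+ 2 by rewrite sumr_ge0 // => ? _; rewrite exprn_ge0.
have sumr0 : \sum_s `|c r s| ^+ 2 = 0 by apply: (psumr_eq0P _ sum0) => // r' _.
have : `|c r s| ^+ 2 = 0 by apply: (psumr_eq0P _ sumr0) => // s' _; rewrite exprn_ge0.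
by move/eqP; rewrite expf_eq0 /= normr_eq0 => /eqP.
Qed.

(** * Amplitudes of one Kraus pair on time-bin kets *)

Lemma delta_adjE (C : numClosedFieldType) n (w : 'cV[C]_n) k :
  ((delta_mx k 0 : 'cV[C]_n)^t* *m w) 0 0 = w k 0.
Proof. by rewrite trmx_delta map_delta_mx -rowE mxE. Qed.

Lemma sum_delta_pair (R : pzRingType) m n (f : 'I_m -> 'I_n -> R) a b :
  \sum_i \sum_j ((i == a) && (j == b))%:R * f i j = f a b.
Proof.
rewrite (bigD1 a) //= [X in _ + X]big1 ?addr0 => [|i /negPf ia]; last first.
  by rewrite big1 // => j _; rewrite ia mul0r.
rewrite (bigD1 b) //= [X in _ + X]big1 ?addr0 ?eqxx ?mul1r // => j /negPf jb.
by rewrite jb andbF mul0r.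
Qed.

Lemma timebin_ket0E (R : realType) N (phi : R) i j :
  timebin_ket phi (0 : 'I_N.+1) (mxpair i j) 0 = ((i == 0) && (j == 0))%:R.
Proof.
rewrite /timebin_ket eqxx !mxE !mxtens.mxtens_indexK /= !andbT.
by rewrite -natrM mulnb.
Qed.

Lemma timebin_ketE (R : realType) N (phi : R) (n : 'I_N.+1) i j : n != 0 ->
  timebin_ket phi n (mxpair i j) 0 = ((Num.sqrt 2)^-1)%:C *
    (((i == n) && (j == 0))%:R + (cos phi +i* sin phi) * ((i == 0) && (j == n))%:R).
Proof.
move=> /negPf n0; rewrite /timebin_ket n0 !mxE !mxtens.mxtens_indexK /= !andbT.
by rewrite -!natrM !mulnb.
Qed.

Lemma timebin_ket_sum (R : realType) N (phi : R) (n : 'I_N.+1)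
    (f : 'I_N.+1 -> 'I_N.+1 -> R[i]) : n != 0 ->
  \sum_i \sum_j timebin_ket phi n (mxpair i j) 0 * f i j =
  ((Num.sqrt 2)^-1)%:C * (f n 0 + (cos phi +i* sin phi) * f 0 n).
Proof.
move=> n0; rewrite -(sum_delta_pair f n 0) -(sum_delta_pair f 0 n).
rewrite mulr_sumr -big_split mulr_sumr; apply: eq_bigr => i _ /=.
rewrite mulr_sumr -big_split mulr_sumr; apply: eq_bigr => j _ /=.
by rewrite timebin_ketE // -mulrA mulrDl mulrA.
Qed.

Lemma sqrt2V_neq0 (R : realType) : ((Num.sqrt 2 : R)^-1)%:C != 0 :> R[i].
Proof. by rewrite fmorph_eq0 invr_eq0 sqrtr_eq0 -ltNge. Qed.

(** The hypotheses are [b + z * d = z * (a + z * c)] at [z = 1], [-1] and ['i]: a polynomial of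
    degree at most two in [z] with three roots has zero coefficients. *)
Lemma phases_coherent (C : numClosedFieldType) (a b c d : C) :
  b + d = a + c -> b - d = - (a - c) -> b + 'i * d = 'i * (a + 'i * c) ->
  b = 0 /\ c = 0 /\ a = d.
Proof.
move=> zero_phase pi_phase i_phase.
have two0 : 2 != 0 :> C by rewrite pnatr_eq0.
have bc : b = c.
  apply: (mulIf two0); transitivity ((b + d) + (b - d)); first by ring.
  by rewrite zero_phase pi_phase; ring.
have ad : a = d by apply: (addIr c); rewrite -zero_phase bc addrC.
suff c0 : c = 0 by rewrite bc c0.
have : c = - c.
  by move: i_phase; rewrite bc -ad mulrDr mulrA -expr2 sqrCi mulN1r addrC => /addrI.
by move/eqP; rewrite -addr_eq0 -mulr2n mulrn_eq0 => /eqP.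
Qed.

Section TimebinOutput.
Variables (R : realType) (N dA dB : nat).
Local Notation C := R[i].
Variables (K : 'M[C]_(N.+1, N.+1 * dA)) (H : 'M[C]_(N.+1, N.+1 * dB)).
Variables (varphi : 'cV[C]_(dA * dB)) (m : 'I_N.+1).

(** For a Kraus pair whose outcomes add up to [m], nothing leaks orthogonally to the input, and the
    output vanishes when [m] differs from [n]. *)
Hypothesis kernel : forall (n : 'I_N.+1) (phi : R) (u : 'cV[C]_(N.+1 * N.+1)),
  0 <= phi < 2 * pi -> (u^t* *m timebin_ket phi n) 0 0 = 0 \/ m != n ->
  (u^t* *m ((K *t H) *m shuffle_ket (timebin_ket phi n) varphi)) 0 0 = 0.

(** Transition amplitude from |i>|j> to |o>|o'>, with the resource contracted. *)
Definition amplitude i j o o' : C :=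
  (kraus_row K o i *m (\matrix_(j, j') varphi (mxpair j j') 0)
    *m (kraus_row H o' j)^T) 0 0.

Let V := amplitude.

Let output0 phi o o' :
  ((K *t H) *m shuffle_ket (timebin_ket phi 0) varphi) (mxpair o o') 0 = V 0 0 o o'.
Proof.
rewrite kraus_shuffle_ket -(sum_delta_pair (fun i j => V i j o o') 0 0).
by apply: eq_bigr => i _; apply: eq_bigr => j _; rewrite timebin_ket0E.
Qed.

Let outputE phi n o o' : n != 0 ->
  ((K *t H) *m shuffle_ket (timebin_ket phi n) varphi) (mxpair o o') 0 =
  ((Num.sqrt 2)^-1)%:C * (V n 0 o o' + (cos phi +i* sin phi) * V 0 n o o').
Proof.
move=> n0; rewrite kraus_shuffle_ket.
exact: (timebin_ket_sum _ (fun i j => V i j o o')).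
Qed.

Let phi0 : 0 <= (0 : R) < 2 * pi. Proof. by rewrite lexx mulr_gt0 ?pi_gt0. Qed.
Let phipi : 0 <= (pi : R) < 2 * pi.
Proof. by rewrite pi_ge0 mulr_natl mulr2n ltrDl pi_gt0. Qed.
Let phipihalf : 0 <= (pi / 2 : R) < 2 * pi.
Proof.
rewrite divr_ge0 ?pi_ge0 //= (le_lt_trans _ (andP phipi).2) //.
by rewrite ler_pdivrMr // ler_peMr ?pi_ge0 // ler1n.
Qed.

Let exp0 : cos (0 : R) +i* sin (0 : R) = 1 :> C. Proof. by rewrite cos0 sin0. Qed.
Let exppi : cos (pi : R) +i* sin (pi : R) = -1 :> C.
Proof. by rewrite cospi sinpi; apply/eqP; rewrite eq_complex /= oppr0 !eqxx. Qed.
Let exppihalf : cos (pi / 2 : R) +i* sin (pi / 2 : R) = 'i :> C.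
Proof. by rewrite cos_pihalf sin_pihalf complexiE. Qed.

Lemma amplitude00_off o o' : (o, o') != (0, 0) -> V 0 0 o o' = 0.
Proof.
move=> oo'; rewrite -(output0 0) -delta_adjE; apply: (kernel phi0); left.
by rewrite delta_adjE timebin_ket0E -xpair_eqE (negPf oo').
Qed.

(** Phases 0 and pi make both the sum and the difference of the two amplitudes vanish. *)
Lemma amplitude_pair_eq0 n o o' : n != 0 ->
  m != n \/ (o, o') != (n, 0) /\ (o, o') != (0, n) ->
  V n 0 o o' = 0 /\ V 0 n o o' = 0.
Proof.
move=> n0 off.
have eq0 phi : 0 <= phi < 2 * pi -> V n 0 o o' + (cos phi +i* sin phi) * V 0 n o o' = 0.
  move=> phiP; apply: (mulfI (sqrt2V_neq0 R)); rewrite mulr0 -outputE // -delta_adjE.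
  apply: (kernel phiP); case: off => [mn|[on0 o0n]]; [by right | left].
  by rewrite delta_adjE timebin_ketE // -!xpair_eqE (negPf on0) (negPf o0n) /= mulr0 addr0 mulr0.
have := eq0 _ phi0; have := eq0 _ phipi; rewrite exp0 exppi mul1r mulN1r.
move=> /subr0_eq ->; rewrite -mulr2n => /eqP; rewrite mulrn_eq0 /= => /eqP V0.
by rewrite V0.
Qed.

Lemma amplitude_coherent n : n != 0 ->
  [/\ V n 0 0 n = 0, V 0 n n 0 = 0 & V n 0 n 0 = V 0 n 0 n].
Proof.
move=> n0; have eqz phi : 0 <= phi < 2 * pi -> let z := cos phi +i* sin phi in
    V n 0 0 n + z * V 0 n 0 n = z * (V n 0 n 0 + z * V 0 n n 0).
  move=> phiP z.
  (* This vector lies in the span of |0>|n> and |n>|0> and is orthogonal to the time-bin ket of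
     phase [phi]. *)
  pose u : 'cV[C]_(N.+1 * N.+1) := delta_mx (mxpair 0 n) 0 - z^* *: delta_mx (mxpair n 0) 0.
  have uE (w : 'cV[C]_(N.+1 * N.+1)) :
      (u^t* *m w) 0 0 = w (mxpair 0 n) 0 - z * w (mxpair n 0) 0.
    have -> : u^t* = (delta_mx (mxpair 0 n) 0 : 'cV[C]_(N.+1 * N.+1))^t*
        - z *: (delta_mx (mxpair n 0) 0 : 'cV[C]_(N.+1 * N.+1))^t*.
      by apply/matrixP => i j; rewrite !mxE rmorphB rmorphM /= conjCK.
    by rewrite mulmxBl -scalemxAl mxE delta_adjE; congr (_ + _); rewrite 2!mxE delta_adjE.
  have := kernel (u := u) (n := n) phiP; rewrite !uE !timebin_ketE // !outputE // -/z.
  rewrite !eqxx /= (negPf n0) (eq_sym 0 n) (negPf n0) /= mulr0 mulr1 addr0 add0r.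
  have -> : ((Num.sqrt 2)^-1)%:C * z - z * (((Num.sqrt 2)^-1)%:C * 1) = 0 :> C.
    by rewrite mulr1 mulrC subrr.
  move=> /(_ (or_introl erefl)); rewrite mulrCA -mulrBr => /eqP.
  by rewrite mulf_eq0 (negPf (sqrt2V_neq0 R)) subr_eq0 => /eqP.
have := eqz _ phi0; have := eqz _ phipi; have := eqz _ phipihalf.
rewrite /= exp0 exppi exppihalf.
rewrite !mulN1r !mul1r => i_phase pi_phase zero_phase.
by have [? [? ?]] := phases_coherent zero_phase pi_phase i_phase.
Qed.
Lemma amplitude_offl n o o' : (o, o') != (n, 0) -> V n 0 o o' = 0.
Proof.
have [->|n0 on0] := eqVneq n 0; first exact: amplitude00_off.
have [[-> ->]|o0n] := eqVneq (o, o') (0, n); first by have [] := amplitude_coherent n0.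
by have [] := amplitude_pair_eq0 n0 (or_intror (conj on0 o0n)).
Qed.

Lemma amplitude_offr n o o' : (o, o') != (0, n) -> V 0 n o o' = 0.
Proof.
have [->|n0 o0n] := eqVneq n 0; first exact: amplitude00_off.
have [[-> ->]|on0] := eqVneq (o, o') (n, 0); first by have [] := amplitude_coherent n0.
by have [] := amplitude_pair_eq0 n0 (or_intror (conj on0 o0n)).
Qed.

Lemma amplitude_sym n : V n 0 n 0 = V 0 n 0 n.
Proof. by have [->//|n0] := eqVneq n 0; have [] := amplitude_coherent n0. Qed.

Lemma amplitude_outcome n : m != n -> V n 0 n 0 = 0.
Proof.
have [->|n0] := eqVneq n 0 => mn; last first.
  by have [] := amplitude_pair_eq0 (o := n) (o' := 0) n0 (or_introl mn).
rewrite -(output0 0) -[LHS]delta_adjE.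
exact: (kernel phi0 (or_intror mn)).
Qed.

End TimebinOutput.

(** * Completeness relations and the entropy bound *)

Lemma trace_preserving_kraus (R : realType) (I J : finType) m n
    (F : I -> 'M[R[i]]_m -> 'M[R[i]]_n) (K : I -> J -> 'M[R[i]]_(n, m)) :
  (forall x X, F x X = \sum_r K x r *m X *m (K x r)^t*) ->
  trace_preserving (fun X => \sum_x F x X) ->
  forall p q, \sum_x \sum_r \sum_o (K x r o p)^* * K x r o q = (p == q)%:R.
Proof.
(* The trace on this matrix unit reads off the [(p, q)] entry of the sum of adjoint Kraus operator
   times Kraus operator. *)
move=> FE tpF p q; have := tpF (delta_mx q p).
have -> : \tr (delta_mx q p : 'M[R[i]]_m) = (p == q)%:R.
  rewrite /mxtrace (bigD1 p) //= [X in _ + X]big1 ?addr0 => [|k /negPf kp].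
    by rewrite mxE eqxx andbT.
  by rewrite mxE kp andbF.
move=> <-; rewrite raddf_sum; apply: eq_bigr => x _ /=.
rewrite FE raddf_sum; apply: eq_bigr => r _ /=; apply: eq_bigr => o _.
rewrite mxE (bigD1 p) //= [X in _ + X]big1 ?addr0 => [|k /negPf kp].
  rewrite !mxE (bigD1 q) //= [X in _ + X]big1 ?addr0 => [|k /negPf kq].
    by rewrite mxE !eqxx mulr1 mulrC.
  by rewrite mxE kq mulr0.
rewrite mxE big1 ?mul0r // => j _.
by rewrite mxE kp andbF mulr0.
Qed.

Lemma trace_preserving_kraus_row (R : realType) (I J : finType) d e
    (F : I -> 'M[R[i]]_(d * e) -> 'M[R[i]]_d) (K : I -> J -> 'M[R[i]]_(d, d * e)) :
  (forall x X, F x X = \sum_r K x r *m X *m (K x r)^t*) ->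
  trace_preserving (fun X => \sum_x F x X) ->
  forall i, \sum_x \sum_r \sum_o
    (kraus_row (K x r) o i)^t* *m kraus_row (K x r) o i = 1%:M.
Proof.
move=> FE tpF i; apply/matrixP => j j'; rewrite mxE.
have := trace_preserving_kraus FE tpF (mxpair i j) (mxpair i j').
rewrite (can_eq (@mxtens.mxtens_indexK _ _)) xpair_eqE eqxx /= => <-.
rewrite summxE; apply: eq_bigr => x _; rewrite summxE; apply: eq_bigr => r _.
rewrite summxE; apply: eq_bigr => o _.
by rewrite mxE big_ord1 !mxE.
Qed.

Lemma ptrace2_ketbra (R : realType) m n (w : 'cV[R[i]]_(m * n)) :
  let M := \matrix_(j, j') w (mxpair j j') 0 in ptrace2 (ketbra w) = M *m M^t*.
Proof.
by apply/matrixP => i j; rewrite !mxE; apply: eq_bigr => k _; rewrite !mxE big_ord1 !mxE.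
Qed.

Lemma unit_vector_mxtrace (R : realType) m n (w : 'cV[R[i]]_(m * n)) :
  let M := \matrix_(j, j') w (mxpair j j') 0 in unit_vector w -> \tr (M *m M^t*) = 1.
Proof.
move=> M <-; rewrite mxE sum_mxpair; apply: eq_bigr => i _.
by rewrite mxE; apply: eq_bigr => j _; rewrite !mxE mulrC.
Qed.

Theorem theorem1 (R : realType) (N dA dB : nat) (hN : (1 <= N)%N)
    (varphi : 'cV[R[i]]_(dA * dB)) (hvarphi : unit_vector varphi)
    (L : 'I_N.+1 -> 'I_N.+1 ->
         'M[R[i]]_(N.+1 * N.+1) -> 'M[R[i]]_(N.+1 * N.+1))
    (hL : LOSE_instrument (ketbra varphi) L)
    (himpl : implements_timebin_detection L) :
  ln (N.+1)%:R <= entanglement_entropy varphi.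
Proof.
have [p [A [B [[p_ge0 p_cvg] cpA cpB [tpA tpB] Lcvg]]]] := hL.
(* The weights sum to 1, so they are not all zero. *)
have [l pl] : exists l, 0 < p l.
  apply/not_existsP => p_le0.
  have p0 l : p l = 0 by apply/eqP; rewrite eq_le p_ge0 andbT leNgt; apply/negP/p_le0.
  have : series p @ \oo --> (0 : R).
    rewrite (_ : series p = fun=> 0); first exact: cvg_cst.
    by apply/funext => k; rewrite /series /= big1.
  move/cvg_lim => /(_ (@Rhausdorff R)); move/cvg_lim: p_cvg => /(_ (@Rhausdorff R)) -> /eqP.
  by rewrite oner_eq0.
have [K KE] := choice (fun x => completely_positive_kraus (cpA l x)).
have [H HE] := choice (fun y => completely_positive_kraus (cpB l y)).
have kernel x y r s (n : 'I_N.+1) (phi : R) (u : 'cV[R[i]]_(N.+1 * N.+1)) :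
    0 <= phi < 2 * pi -> (u^t* *m timebin_ket phi n) 0 0 = 0 \/ x + y != n ->
    (u^t* *m ((K x r *t H y s) *m shuffle_ket (timebin_ket phi n) varphi)) 0 0 = 0.
  move=> phiP dark.
  have uLu : (u^t* *m L x y (timebin_state phi n) *m u) 0 0 = 0.
    have [c -> c0] := implements_output himpl n x y phiP.
    case: dark => [upsi|/c0 ->]; last by rewrite scale0r mulmx0 mul0mx mxE.
    rewrite -scalemxAr -scalemxAl mxE /timebin_state /ketbra.
    rewrite (mulmxA (u^t* )) -(mulmxA (u^t* *m _)).
    by rewrite [X in _ * X = _]mxE big_ord1 upsi mul0r mulr0.
  pose T k := tensmap (A k x) (B k y) (shuffle (timebin_state phi n *t ketbra varphi)).
  (* Positivity at every value of the randomness lets the vanishing of the averaged form pass to the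
     value [l]. *)
  have psdT k : psd (T k).
    have [K' KE'] := completely_positive_kraus (cpA k x).
    have [H' HE'] := completely_positive_kraus (cpB k y).
    move=> v; rewrite /T (tensmap_kraus KE' HE') shuffle_ketbra.
    rewrite mulmx_sumr mulmx_suml summxE sumr_ge0 // => r' _.
    rewrite mulmx_sumr mulmx_suml summxE sumr_ge0 // => s' _.
    have := psd_ketbra (shuffle_ket (timebin_ket phi n) varphi) ((K' r' *t H' s')^t* *m v).
    by rewrite adjmxM trmxCK !mulmxA.
  have := psd_series_form_eq0 p_ge0 psdT (Lcvg x y _) uLu pl.
  by rewrite /T (tensmap_kraus (KE x) (HE y)) shuffle_ketbra => /kraus_kernel; apply.
rewrite /entanglement_entropy ptrace2_ketbra; set M := \matrix_(j, j') _.
have trM : \tr (M *m M^t*) = 1 by exact: unit_vector_mxtrace.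
apply: ler_ln_entropy => // v lam v0 lam0 vE; rewrite -trM.
(* Bob's blocks are transposed into columns, so that a M b is exactly an [amplitude]. *)
pose a x r o i := kraus_row (K x r) o i; pose b y s o i := (kraus_row (H y s) o i)^T.
have mx11_ext (X Y : 'M[R[i]]_1) : X 0 0 = Y 0 0 -> X = Y.
  by move=> XY; apply/matrixP => i j; rewrite !ord1.
apply: (kraus_eigenvalue_le (M := M) (a := a) (b := b) _ _ _ _ _ _ v0 lam0 vE).
- exact: trace_preserving_kraus_row KE (tpA l).
(* Completeness for Bob's columns is the transpose of the relation for rows. *)
- move=> i; rewrite -[RHS]trmx1 -(trace_preserving_kraus_row HE (tpB l) i) raddf_sum.
  apply: eq_bigr => y _ /=; rewrite raddf_sum; apply: eq_bigr => s _ /=.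
  rewrite raddf_sum; apply: eq_bigr => o _ /=.
  by rewrite trmx_mul map_trmx trmxK.
- move=> x r y s i o o' oo'; apply: mx11_ext; rewrite [RHS]mxE.
  exact: amplitude_offl (kernel x y r s) _ _ _ oo'.
- move=> x r y s i o o' oo'; apply: mx11_ext; rewrite [RHS]mxE.
  exact: amplitude_offr (kernel x y r s) _ _ _ oo'.
- move=> x r y s i xyi; apply: mx11_ext; rewrite [RHS]mxE.
  exact: amplitude_outcome (kernel x y r s) _ xyi.
- move=> x r y s i; apply: mx11_ext.
  exact: amplitude_sym (kernel x y r s) i.
Qed.
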